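(* Let $\mathcal{F}$ be a cellular sheaf (discourse sheaf) on a finite connected graph $G=(V,E)$, let $U\subseteq V$ be a set of stubborn vertices with stubborn subspaces $S_v\subseteq\mathcal{F}(v)$ ($S_v=\{0\}$ for $v\notin U$), and let $\mathcal{Q}$ be the sheaf of free opinions. Fix $u\in C^0(S)$, let $\alpha>0$, and let $x=\tilde u+\tilde y$, where $y(t)\in C^0(\mathcal{Q})$ evolves according to $$\frac{dy}{dt}=-\alpha\bigl(L_{\mathcal{Q}}\,y+L_{QS}\,u\bigr).$$ Then for any initial condition $y(0)\in C^0(\mathcal{Q})$, with $x(0)=\tilde u+\tilde y(0)$: 1. $y(t)$ converges exponentially as $t\to\infty$ to a limit $y^\infty\in C^0(\mathcal{Q})$ satisfying the sheaf Poisson equation $L_{\mathcal{Q}}\,y^\infty=-L_{QS}\,u$. 2. The solution set $\mathcal{A}=\{y\in C^0(\mathcal{Q}) : L_{\mathcal{Q}}y=-L_{QS}u\}$ is an affine subspace with direction space $H^0(G;\mathcal{Q})=\ker(L_{\mathcal{Q}})$, and $y^\infty$ is the point of $\mathcal{A}$ closest to $y(0)$; explicitly, $$y^\infty=y(0)-L_{\mathcal{Q}}^\dagger P_{\mathcal{Q}}L_{\mathcal{F}}\,x(0).$$ 3. The total state $x^\infty=\tilde u+\tilde y^\infty$ minimizes the disagreement energy subject to the stubborn constraints: $$x^\infty\in\operatorname*{argmin}_{x\in C^0(G;\mathcal{F}):\,P_S(x)=u}\|\delta x\|^2.$$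
   Context: A cellular sheaf (discourse sheaf) $\mathcal{F}$ on a graph $G=(V,E)$ assigns a finite-dimensional real inner product space $\mathcal{F}(v)$ to each vertex $v$, a finite-dimensional real inner product space $\mathcal{F}(e)$ to each edge $e$, and a linear restriction map $\mathcal{F}_{v\unlhd e}:\mathcal{F}(v)\to\mathcal{F}(e)$ to each incidence $v\in e$ (written $v\unlhd e$). Put $C^0(G;\mathcal{F})=\bigoplus_{v}\mathcal{F}(v)$ and $C^1(G;\mathcal{F})=\bigoplus_e\mathcal{F}(e)$ with the direct-sum inner products. Choosing an arbitrary orientation of every edge $e=u\to v$, the coboundary $\delta:C^0\to C^1$ is $(\delta x)_e=\mathcal{F}_{v\unlhd e}(x_v)-\mathcal{F}_{u\unlhd e}(x_u)$. The sheaf Laplacian is $L_{\mathcal{F}}=\delta^T\delta$ (adjoint with respect to the inner products), and $H^0(G;\mathcal{F})=\ker\delta=\ker L_{\mathcal{F}}$. For each $v$, $T_v=S_v^\perp\subseteq\mathcal{F}(v)$ is the subspace of free directions. The sheaf of free opinions $\mathcal{Q}$ has stalks $\mathcal{Q}(v)=T_v$, $\mathcal{Q}(e)=\mathcal{F}(e)$ and restriction maps $\mathcal{Q}_{v\unlhd e}=\mathcal{F}_{v\unlhd e}|_{T_v}$. Then $C^0(G;\mathcal{F})=C^0(S)\oplus C^0(\mathcal{Q})$ orthogonally, where $C^0(S)=\bigoplus_vS_v$ and $C^0(\mathcal{Q})=\bigoplus_vT_v$; $\iota_S,\iota_{\mathcal{Q}}$ are the inclusions, $P_S,P_{\mathcal{Q}}$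 the orthogonal projections onto the two summands, and $\tilde u=\iota_S(u)$, $\tilde y=\iota_{\mathcal{Q}}(y)$. In this splitting $L_{\mathcal{F}}=\begin{bmatrix}L_{SS}&L_{SQ}\\L_{QS}&L_{QQ}\end{bmatrix}$, where $L_{QS}:C^0(S)\to C^0(\mathcal{Q})$ and $L_{QQ}=L_{\mathcal{Q}}$ is the sheaf Laplacian of $\mathcal{Q}$. The symbol $\dagger$ denotes the Moore–Penrose pseudoinverse. *)

(* Defs.v *)
From HB Require Import structures.
From mathcomp Require Import all_boot all_order all_algebra.
From mathcomp Require Import sesquilinear ring lra.
From mathcomp Require Import all_classical all_reals all_analysis.

Set Implicit Arguments.
Unset Strict Implicit.
Unset Printing Implicit Defensive.

Import Order.TTheory GRing.Theory Num.Theory.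
Import numFieldNormedType.Exports.

Local Open Scope ring_scope.

(* A finite-dimensional real inner product space, with the norm topology. *)
HB.mixin Record isEuclidean (R : realType) V
    & Vector R V & NormedModule R V := {
  dotp : {dot V for @idfun R};
  norm_dotp : forall x : V, `|x| = Num.sqrt (dotp x x)
}.

#[short(type="euclideanType")]
HB.structure Definition Euclidean (R : realType) :=
  {V of Vector R V & NormedModule R V & isEuclidean R V}.

HB.factory Record Vector_isEuclidean (R : realType) V & Vector R V := {
  dot : V -> V -> R;
  dot_linear : forall y, scalar (dot^~ y);
  dot_sym : forall x y, dot x y = dot y x;
  dot_gt0 : forall x, x != 0 -> 0 < dot x x
}.

HB.builders Context R V & Vector_isEuclidean R V.

Let dot_linr x : scalar (dot x).
Proof. by move=> a u v; rewrite !(dot_sym x) dot_linear. Qed.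

HB.instance Definition _ :=
  @bilinear_isBilinear.Build R V V R ( *%R : GRing.Scale.law R R)
    (@idfun R \; *%R : GRing.Scale.law R R) dot (dot_linear, dot_linr).

Let dot_herm x y : dot x y = (-1) ^+ false * idfun (dot y x).
Proof. by rewrite expr0 mul1r dot_sym. Qed.

HB.instance Definition _ :=
  @isHermitianSesquilinear.Build R V false (@idfun R) dot dot_herm.
HB.instance Definition _ := isDotProduct.Build R V dot dot_gt0.

Let f : {dot V for @idfun R} := dot.

Let nrm x := Num.sqrt (f x x).

Let fC x y : f x y = f y x. Proof. exact: dot_sym. Qed.

Let f_ge0 x : 0 <= f x x.
Proof.
by have [->|x0] := eqVneq x 0; rewrite ?linear0r//; exact/ltW/dot_gt0.
Qed.

Let nrmZ (l : R) x : nrm (l *: x) = `|l| * nrm x.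
Proof.
rewrite /nrm linearZl_LR linearZr_LR/= mulrA -expr2 sqrtrM ?sqr_ge0//.
by rewrite sqrtr_sqr.
Qed.

Let nrm0_eq0 x : nrm x = 0 -> x = 0.
Proof.
move=> /eqP; rewrite sqrtr_eq0 => fx; apply/eqP; apply: contraTT fx => x0.
by rewrite -ltNge; exact: dot_gt0.
Qed.

Let fE x y (c : R) :
  f (c *: x - y) (c *: x - y) = c ^+ 2 * f x x - c *+ 2 * f x y + f y y.
Proof.
have fl z : f (c *: x - y) z = c * f x z - f y z.
  by rewrite linearBl/= linearZl_LR.
rewrite fl !(fC _ (c *: x - y)) !fl (fC y x).
by ring.
Qed.

Let nrmD x y : nrm (x + y) <= nrm x + nrm y.
Proof.
rewrite -(ler_pXn2r (n := 2))// ?nnegrE ?addr_ge0 ?sqrtr_ge0//.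
rewrite sqrrD !sqr_sqrtr ?f_ge0// linearDl !linearDr/= (fC y x) -[dot x y]/(f x y).
have CS : f x y <= nrm x * nrm y.
  apply: le_trans (ler_norm _) _.
  rewrite -(ler_pXn2r (n := 2))// ?nnegrE ?mulr_ge0 ?sqrtr_ge0//.
  rewrite exprMn !sqr_sqrtr ?f_ge0// real_normK ?num_real//.
  have [->|x0] := eqVneq x 0; first by rewrite !linear0l expr0n.
  have fx := dot_gt0 x0; have := f_ge0 ((f x y / f x x) *: x - y).
  rewrite fE -(pmulr_rge0 _ fx).
  have -> : f x x * ((f x y / f x x) ^+ 2 * f x x
      - (f x y / f x x) *+ 2 * f x y + f y y) = f x x * f y y - f x y ^+ 2.
    by field; rewrite gt_eqF.
  by rewrite subr_ge0.
move: CS; move: (f x x) (f x y) (f y y) (nrm x * nrm y) => a b c d CS.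
by rewrite mulr2n; lra.
Qed.

HB.instance Definition _ := @Lmodule_isNormed.Build R V nrm nrmD nrmZ nrm0_eq0.
HB.instance Definition _ := isEuclidean.Build R V (dotp := f) (fun=> erefl).
HB.end.

Section SubEuclidean.
Variables (R : realType) (V : euclideanType R) (A : {vspace V}).

Let sdot (x y : subvs_of A) : R := dotp (vsval x) (vsval y).

Fact sdot_linear y : scalar (sdot^~ y).
Proof. by move=> a u v; rewrite /sdot linearP linearDl/= linearZl_LR. Qed.

Fact sdot_sym x y : sdot x y = sdot y x.
Proof. by rewrite /sdot hermC expr0 mul1r. Qed.

Fact sdot_gt0 x : x != 0 -> 0 < sdot x x.
Proof. by move=> x0; apply: neq0_dnorm_gt0. Qed.

HB.instance Definition _ :=
  @Vector_isEuclidean.Build R (subvs_of A) sdot sdot_linear sdot_sym sdot_gt0.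

Lemma dotp_subvsE (x y : subvs_of A) : dotp x y = dotp (vsval x) (vsval y).
Proof. by []. Qed.

End SubEuclidean.

(* The orthogonal direct sum of a finite family of inner product spaces. *)
Definition dsum (R : realType) (I : finType) (V : I -> euclideanType R) : Type :=
  {dffun forall i, V i}.

Section DirectSum.
Variables (R : realType) (I : finType) (V : I -> euclideanType R).
Local Notation D := (dsum V).

Definition mk_dsum (f : forall i, V i) : D := finfun f.
Definition dcomp (i : I) (x : D) : V i := x i.

Lemma mk_dsumE f i : dcomp i (mk_dsum f) = f i.
Proof. exact: ffunE. Qed.

Lemma dsumP (x y : D) : (forall i, dcomp i x = dcomp i y) <-> x = y.
Proof. by split=> [xy|->//]; apply/ffunP. Qed.

HB.instance Definition _ := Choice.copy D {dffun forall i, V i}.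

Let dzero := mk_dsum (fun=> 0).
Let dopp x := mk_dsum (fun i => - dcomp i x).
Let dadd x y := mk_dsum (fun i => dcomp i x + dcomp i y).
Let dscale (a : R) x := mk_dsum (fun i => a *: dcomp i x).

Fact daddA : associative dadd.
Proof. by move=> x y z; apply/dsumP=> i; rewrite !mk_dsumE addrA. Qed.
Fact daddC : commutative dadd.
Proof. by move=> x y; apply/dsumP=> i; rewrite !mk_dsumE addrC. Qed.
Fact dadd0 : left_id dzero dadd.
Proof. by move=> x; apply/dsumP=> i; rewrite !mk_dsumE add0r. Qed.
Fact daddN : left_inverse dzero dopp dadd.
Proof. by move=> x; apply/dsumP=> i; rewrite !mk_dsumE addNr. Qed.

HB.instance Definition _ := GRing.isZmodule.Build D daddA daddC dadd0 daddN.

Fact dscaleA a b x : dscale a (dscale b x) = dscale (a * b) x.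
Proof. by apply/dsumP=> i; rewrite !mk_dsumE scalerA. Qed.
Fact dscale1 : left_id 1 dscale.
Proof. by move=> x; apply/dsumP=> i; rewrite !mk_dsumE scale1r. Qed.
Fact dscaleDr : right_distributive dscale +%R.
Proof. by move=> a x y; apply/dsumP=> i; rewrite !mk_dsumE scalerDr. Qed.
Fact dscaleDl x : {morph dscale^~ x : a b / a + b}.
Proof. by move=> a b; apply/dsumP=> i; rewrite !mk_dsumE scalerDl. Qed.

HB.instance Definition _ :=
  GRing.Zmodule_isLmodule.Build R D dscaleA dscale1 dscaleDr dscaleDl.

Fact dcomp_linear i : linear (dcomp i).
Proof. by move=> a x y; rewrite !mk_dsumE. Qed.

HB.instance Definition _ i :=
  GRing.isLinear.Build R D (V i) *:%R (dcomp i) (dcomp_linear i).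

Import VectorInternalTheory.

Let K : finType := {i : I & 'I_(dim (V i))}.

Fact dsum_vect_iso : Vector.axiom #|{: K}| D.
Proof.
pose f (x : D) : 'rV[R]_(#|{: K}|) :=
  \row_(j < #|{: K}|) v2r (dcomp (tag (enum_val j)) x) 0 (tagged (enum_val j)).
exists f; first by move=> a x y; apply/rowP=> j; rewrite !mxE linearP linearP !mxE.
exists (fun r : 'rV[R]_(#|{: K}|) =>
  mk_dsum (fun i => r2v (\row_k r 0 (enum_rank (existT _ i k : K))))).
  move=> x; apply/dsumP=> i; rewrite mk_dsumE; apply: (canLR v2rK).
  by apply/rowP=> k; rewrite !mxE enum_rankK.
move=> r; apply/rowP=> j; rewrite !mxE mk_dsumE r2vK mxE.
by congr (r 0 _); rewrite -[RHS]enum_valK; congr enum_rank; case: (enum_val j).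
Qed.

HB.instance Definition _ := Lmodule_hasFinDim.Build R D dsum_vect_iso.

Let ddot (x y : D) : R := \sum_i dotp (dcomp i x) (dcomp i y).

Fact ddot_linear y : scalar (ddot^~ y).
Proof.
move=> a u v; rewrite /ddot mulr_sumr -big_split/=; apply: eq_bigr => i _.
by rewrite linearP linearDl/= linearZl_LR.
Qed.

Fact ddot_sym x y : ddot x y = ddot y x.
Proof. by apply: eq_bigr => i _; rewrite hermC expr0 mul1r. Qed.

Fact ddot_gt0 x : x != 0 -> 0 < ddot x x.
Proof.
have dotp_ge0 i : 0 <= dotp (dcomp i x) (dcomp i x).
  have [->|xi] := eqVneq (dcomp i x) 0; first by rewrite linear0r.
  exact/ltW/neq0_dnorm_gt0.
move=> x0; rewrite lt_def sumr_ge0// andbT; apply: contra x0.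
rewrite psumr_eq0// => /allP xx0; apply/eqP/dsumP => i; rewrite mk_dsumE.
apply/eqP; apply: contraTT (xx0 i (mem_index_enum _)) => xi0.
by rewrite gt_eqF// neq0_dnorm_gt0.
Qed.

HB.instance Definition _ :=
  @Vector_isEuclidean.Build R D ddot ddot_linear ddot_sym ddot_gt0.

Lemma dotp_dsumE (x y : D) : dotp x y = \sum_i dotp (dcomp i x) (dcomp i y).
Proof. by []. Qed.

End DirectSum.

Section LinearMaps.
Variable R : realType.
Implicit Types X Y : euclideanType R.

Lemma dotpC X (x y : X) : dotp x y = dotp y x.
Proof. by rewrite hermC expr0 mul1r. Qed.

Lemma dotp_eq0 X (x : X) : (forall y, dotp x y = 0) -> x = 0.
Proof.
move=> x0; apply/eqP; apply: contraT => /(@neq0_dnorm_gt0 _ _ _ dotp).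
by rewrite x0 ltxx.
Qed.

Definition is_adjoint X Y (f : 'Hom(X, Y)) (g : 'Hom(Y, X)) : Prop :=
  forall x y, dotp (f x) y = dotp x (g y).

(* [adjointP] shows that the default value [0] is never used; likewise
   [pseudoinverseP] below. *)
Definition adjoint X Y (f : 'Hom(X, Y)) : 'Hom(Y, X) :=
  xget 0 [set g | is_adjoint f g]%classic.

Lemma dotp_riesz X (h : X -> R) : scalar h -> exists z, forall x, h x = dotp x z.
Proof.
move=> lin_h.
pose phi (z : X) : 'Hom(X, R^o) := linfun (dotp z : X -> R^o).
have phiE z x : phi z x = dotp z x by rewrite lfunE.
have phi_lin : linear phi.
  move=> a u v; apply/lfunP => x; rewrite add_lfunE scale_lfunE !phiE.
  by rewrite linearDl/= linearZl_LR.
pose h' : {linear X -> R^o} :=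
  HB.pack (h : X -> R^o) (GRing.isLinear.Build R X R^o *:%R h lin_h).
pose phi' : {linear X -> 'Hom(X, R^o)} :=
  HB.pack phi (GRing.isLinear.Build R X 'Hom(X, R^o) *:%R phi phi_lin).
have kphi : lker (linfun phi') == 0%VS.
  rewrite -subv0; apply/subvP => z; rewrite memv_ker lfunE/= memv0 => /eqP z0.
  by apply/eqP/dotp_eq0 => y; rewrite -phiE z0 lfunE.
have : linfun h' \in limg (linfun phi').
  suff -> : limg (linfun phi') = fullv by rewrite memvf.
  apply/eqP; rewrite eqEdim subvf/=.
  rewrite limg_dim_eq ?dimvf; last by rewrite (eqP kphi) capv0.
  by rewrite /dim/= muln1.
move=> /memv_imgP[z _ hz]; exists z => x.
by rewrite dotpC -phiE -[h x]/(h' x) -[h' x]lfunE hz lfunE.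
Qed.

Lemma adjointP X Y (f : 'Hom(X, Y)) : is_adjoint f (adjoint f).
Proof.
rewrite /adjoint; case: xgetP => [g -> //|noadj]; exfalso.
have ex y : exists z, forall x, dotp (f x) y = dotp x z.
  apply: dotp_riesz => a u v.
  by rewrite linearP linearDl/= linearZl_LR.
have [g gP] := choice ex.
have glin : linear g.
  move=> a u v; apply/eqP; rewrite -subr_eq0; apply/eqP/dotp_eq0 => x.
  rewrite dotpC linearBr/= linearDr/= linearZr_LR/= -!gP.
  by rewrite linearDr/= linearZr_LR/= subrr.
pose g' : {linear Y -> X} :=
  HB.pack g (GRing.isLinear.Build R Y X *:%R g glin).
by apply: (noadj (linfun g')) => x y; rewrite lfunE gP.
Qed.

(* The orthogonal projection onto [A], as a map into [A] itself. *)
Definition orthproj X (A : {vspace X}) : 'Hom(X, subvs_of A) :=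
  (linfun (vsproj A) \o daddv_pi A (orthov dotp A))%VF.

Lemma capv_orthov X (A : {vspace X}) : (A :&: orthov dotp A = 0)%VS.
Proof.
apply/eqP; rewrite -subv0; apply/subvP => x; rewrite memv_cap memv0.
move=> /andP[xA /mem_orthovP/(_ _ xA) xx]; apply: contraT.
by move=> /(@neq0_dnorm_gt0 _ _ _ dotp); rewrite xx ltxx.
Qed.

Lemma addv_orthov X (A : {vspace X}) : (A + orthov dotp A = fullv)%VS.
Proof.
apply/eqP; rewrite eqEsubv subvf/=; apply/subvP => x _.
have [|z xz] := @dotp_riesz (subvs_of A) (fun a => dotp x (vsval a)).
  move=> c u v; rewrite -[vsval _]/(c *: vsval u + vsval v).
  by rewrite linearDr/= linearZr_LR.
rewrite -[x](subrKC (vsval z)) memv_add ?subvsP//.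
apply/mem_orthovP => a aA; have := xz (vsproj A a).
rewrite dotp_subvsE vsprojK// linearBl/= => ->.
by rewrite dotpC subrr.
Qed.

Lemma orthproj_in X (A : {vspace X}) x :
  vsval (orthproj A x) = daddv_pi A (orthov dotp A) x.
Proof.
rewrite comp_lfunE; set z := daddv_pi _ _ x.
have -> : linfun (vsproj A) z = vsproj A z by exact: lfunE.
by rewrite vsprojK// memv_pi.
Qed.

Lemma orthproj_sub X (A : {vspace X}) x :
  x - vsval (orthproj A x) \in orthov dotp A.
Proof.
rewrite orthproj_in -{1}(@daddv_pi_add _ _ _ _ x (capv_orthov A)).
  by rewrite addrC addKr memv_pi.
by rewrite addv_orthov memvf.
Qed.

(* The four Penrose conditions. *)
Definition is_pseudoinverse X Y (f : 'Hom(X, Y)) (g : 'Hom(Y, X)) : Prop :=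
  [/\ (f \o g \o f)%VF = f, (g \o f \o g)%VF = g,
      adjoint (f \o g)%VF = (f \o g)%VF & adjoint (g \o f)%VF = (g \o f)%VF].

Definition pseudoinverse X Y (f : 'Hom(X, Y)) : 'Hom(Y, X) :=
  xget 0 [set g | is_pseudoinverse f g]%classic.

Lemma adjoint_unique X Y (f : 'Hom(X, Y)) (g : 'Hom(Y, X)) :
  is_adjoint f g -> adjoint f = g.
Proof.
move=> fg; apply/lfunP => y; apply/eqP; rewrite -subr_eq0; apply/eqP/dotp_eq0.
by move=> x; rewrite dotpC linearBr/= -fg -(adjointP f) subrr.
Qed.

Lemma daddv_pi_adjoint X (A : {vspace X}) (p := daddv_pi A (orthov dotp A)) :
  adjoint p = p.
Proof.
have pA x : p x \in A by exact: memv_pi.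
have po x y : dotp (x - p x) (p y) = 0.
  by have := orthproj_sub A x; rewrite orthproj_in => /mem_orthovP; apply.
apply: adjoint_unique => x y.
have /eqP := po x y; rewrite linearBl/= subr_eq0 => /eqP ->.
by have /eqP := po y x; rewrite linearBl/= subr_eq0 dotpC => /eqP ->; rewrite dotpC.
Qed.

Lemma pseudoinverseP X Y (f : 'Hom(X, Y)) : is_pseudoinverse f (pseudoinverse f).
Proof.
rewrite /pseudoinverse; case: xgetP => [g -> //|nog]; exfalso.
pose I := limg f; pose K := lker f.
pose pI := daddv_pi I (orthov dotp I); pose pK := daddv_pi K (orthov dotp K).
have pI_id y : y \in I -> pI y = y by apply: daddv_pi_id (capv_orthov I).
have pI_in y : pI y \in I by exact: memv_pi.
have pK_id x : x \in K -> pK x = x by apply: daddv_pi_id (capv_orthov K).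
have fpK x : f (pK x) = 0 by apply/eqP; rewrite -memv_ker memv_pi.
pose g := ((\1 - pK) \o f^-1 \o pI)%VF.
have gE y : g y = f^-1%VF (pI y) - pK (f^-1%VF (pI y)).
  by rewrite /g comp_lfunE comp_lfunE add_lfunE opp_lfunE id_lfunE.
have fg : (f \o g)%VF = pI.
  by apply/lfunP => y; rewrite comp_lfunE gE linearB/= fpK subr0 limg_lfunVK.
have gf : (g \o f)%VF = (\1 - pK)%VF.
  apply/lfunP => x; rewrite comp_lfunE gE add_lfunE opp_lfunE id_lfunE.
  rewrite pI_id ?memv_img ?memvf//; set z := f^-1%VF _.
  have xzK : x - z \in K.
    by rewrite memv_ker linearB/= subr_eq0 limg_lfunVK ?memv_img ?memvf.
  apply/eqP; rewrite -subr_eq0 opprB addrACA [z + _]addrC -addrACA -linearB/=.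
  by rewrite pK_id// addrC subrKA subrr.
apply: (nog g); split.
- by apply/lfunP => x; rewrite fg comp_lfunE pI_id ?memv_img ?memvf.
- apply/lfunP => y; rewrite gf comp_lfunE add_lfunE opp_lfunE id_lfunE gE.
  by rewrite linearB/= (pK_id (pK _)) ?memv_pi// subrr subr0.
- by rewrite fg; exact: daddv_pi_adjoint.
- rewrite gf; apply: adjoint_unique => x y.
  rewrite !add_lfunE !opp_lfunE !id_lfunE linearBl linearBr/=.
  by rewrite (adjointP pK) daddv_pi_adjoint.
Qed.

End LinearMaps.

(* Finite simple graphs: an edge is a set of two vertices. *)
Record graph := Graph {
  vertex : finType;
  edges : {set {set vertex}};
  edges_card2 : forall e, e \in edges -> #|e| = 2%N
}.

Definition edge (G : graph) : finType := {e : {set vertex G} | e \in edges G}.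

Definition incident (G : graph) (v : vertex G) (e : edge G) : bool := v \in val e.

Definition adjacent (G : graph) : rel (vertex G) :=
  fun v w => [set v; w]%SET \in edges G.

Definition connected_graph (G : graph) : Prop :=
  forall v w : vertex G, connect (@adjacent G) v w.

Record orientation (G : graph) := Orientation {
  etail : edge G -> vertex G;
  ehead : edge G -> vertex G;
  orientationP : forall e, val e = [set etail e; ehead e]%SET
}.

Lemma etail_incident G (o : orientation G) e : incident (etail o e) e.
Proof. by rewrite /incident (orientationP o) !inE eqxx. Qed.

Lemma ehead_incident G (o : orientation G) e : incident (ehead o e) e.
Proof. by rewrite /incident (orientationP o) !inE eqxx orbT. Qed.

Record sheaf (R : realType) (G : graph) := Sheaf {
  vstalk : vertex G -> euclideanType R;
  estalk : edge G -> euclideanType R;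
  restr : forall v e, incident v e -> 'Hom(vstalk v, estalk e)
}.

Section Sheaf.
Variables (R : realType) (G : graph).
Implicit Types (o : orientation G) (F : sheaf R G).

Definition C0 F := dsum (vstalk F).
Definition C1 F := dsum (estalk F).

Definition coboundary_fun o F (x : C0 F) : C1 F :=
  mk_dsum (fun e => restr F (ehead_incident o e) (dcomp (ehead o e) x)
                    - restr F (etail_incident o e) (dcomp (etail o e) x)).

Definition coboundary o F : 'Hom(C0 F, C1 F) := linfun (@coboundary_fun o F).

Definition laplacian o F : 'Hom(C0 F, C0 F) :=
  (adjoint (coboundary o F) \o coboundary o F)%VF.

(* The space of global sections [H^0(G; F)]. *)
Definition H0 o F : {vspace C0 F} := lker (coboundary o F).

(* The direct sum of a family of subspaces [A v] of the vertex stalks, with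
   its inclusion into [C0 F] and the orthogonal projection onto it. *)
Definition C0sub F (A : forall v, {vspace vstalk F v}) :=
  dsum (fun v => subvs_of (A v) : euclideanType R).

Definition C0_incl F (A : forall v, {vspace vstalk F v}) :
    'Hom(C0sub A, C0 F) :=
  linfun (fun x : C0sub A => mk_dsum (fun v => vsval (dcomp v x)) : C0 F).

Definition C0_proj F (A : forall v, {vspace vstalk F v}) :
    'Hom(C0 F, C0sub A) :=
  linfun (fun x : C0 F => mk_dsum (fun v => orthproj (A v) (dcomp v x)) : C0sub A).

Definition free_dirs F (S : forall v, {vspace vstalk F v}) v :
    {vspace vstalk F v} := orthov dotp (S v).

Definition free_sheaf F (S : forall v, {vspace vstalk F v}) : sheaf R G := {|
  vstalk := fun v => subvs_of (free_dirs S v) : euclideanType R;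
  estalk := estalk F;
  restr := fun v e (ve : incident v e) =>
    (restr F ve \o linfun (vsval : subvs_of (free_dirs S v) -> _))%VF
|}.

Lemma coboundaryE o F x : coboundary o F x = coboundary_fun o x.
Proof.
have lin : linear (@coboundary_fun o F).
  move=> a y z; apply/dsumP => e; rewrite linearP/= !mk_dsumE !linearP/=.
  by rewrite scalerBr -scalerN addrACA.
pose f : {linear C0 F -> C1 F} := HB.pack (@coboundary_fun o F)
  (GRing.isLinear.Build R (C0 F) (C1 F) *:%R (@coboundary_fun o F) lin).
by rewrite -[RHS]/(f x) -[RHS](lfunE f).
Qed.

Lemma C0_inclE F (A : forall v, {vspace vstalk F v}) x v :
  dcomp v (C0_incl A x) = vsval (dcomp v x).
Proof.
pose g (y : C0sub A) : C0 F := mk_dsum (fun v => vsval (dcomp v y)).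
have lin : linear g.
  by move=> a y z; apply/dsumP => w; rewrite linearP/= !mk_dsumE linearP.
pose f : {linear C0sub A -> C0 F} :=
  HB.pack g (GRing.isLinear.Build R (C0sub A) (C0 F) *:%R g lin).
by rewrite /C0_incl -[LHS]/(dcomp v (linfun f x)) lfunE/= mk_dsumE.
Qed.

Lemma C0_projE F (A : forall v, {vspace vstalk F v}) x v :
  dcomp v (C0_proj A x) = orthproj (A v) (dcomp v x).
Proof.
pose g (y : C0 F) : C0sub A := mk_dsum (fun v => orthproj (A v) (dcomp v y)).
have lin : linear g.
  by move=> a y z; apply/dsumP => w; rewrite linearP/= !mk_dsumE !linearP.
pose f : {linear C0 F -> C0sub A} :=
  HB.pack g (GRing.isLinear.Build R (C0 F) (C0sub A) *:%R g lin).
by rewrite /C0_proj -[LHS]/(dcomp v (linfun f x)) lfunE/= mk_dsumE.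
Qed.

(* The inclusion of, and the orthogonal projection onto, the free summand;
   [C0 (free_sheaf S)] is convertible to [C0sub (free_dirs S)]. *)
Definition free_incl F (S : forall v, {vspace vstalk F v}) :
  'Hom(C0 (free_sheaf S), C0 F) := C0_incl (free_dirs S).

Definition free_proj F (S : forall v, {vspace vstalk F v}) :
  'Hom(C0 F, C0 (free_sheaf S)) := C0_proj (free_dirs S).

(* The block [L_QS] of the sheaf Laplacian. *)
Definition laplacian_QS o F (S : forall v, {vspace vstalk F v}) :
    'Hom(C0sub S, C0 (free_sheaf S)) :=
  (free_proj S \o laplacian o F \o C0_incl S)%VF.

End Sheaf.

Section Analysis.
Variables (R : realType) (X : euclideanType R).
Implicit Types (A : set X) (y : R -> X).
Local Open Scope classical_set_scope.

(* A solution on the half-line [0, +oo[ of the initial value problem for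
   [y' = f y]; at the endpoint 0 only right continuity makes sense. *)
Definition solves_ode y (f : X -> X) : Prop :=
  {within `[0, +oo[, continuous y} /\
  forall t : R, 0 < t -> is_derive t (1 : R) y (f (y t)).

Definition converges_exponentially y (l : X) : Prop :=
  y t @[t --> +oo%R] --> l /\
  exists C rate : R, 0 < rate /\
    forall t, 0 <= t -> `|y t - l| <= C * expR (- rate * t).

Definition affine_subspace A (D : {vspace X}) : Prop :=
  exists a : X, A = [set z | z - a \in D].

Definition closest_point A (p q : X) : Prop :=
  A q /\ forall z, A z -> z != q -> `|p - q| < `|p - z|.

Definition argmin A (J : X -> R) : set X :=
  [set x | A x /\ forall z, A z -> J x <= J z].

End Analysis.

(* Main.v *)
Require Import Defs.
From mathcomp Require Import all_boot all_order all_algebra.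
From mathcomp Require Import all_classical all_reals all_analysis.
From mathcomp Require Import sesquilinear ring lra.

Import Order.TTheory GRing.Theory Num.Theory.
Import numFieldNormedType.Exports.

Local Open Scope ring_scope.

(** The flow is the gradient descent of a least-squares problem.  Put
    [X := C0 Q], let [f : X -> Y] be the coboundary of the sheaf of free
    opinions and let [w] be the coboundary of the stubborn part [u].  Since the
    coboundary of [F] restricts to [f] on free cochains ([coboundary_free]) and
    the projection onto free cochains is adjoint to their inclusion
    ([C0_incl_adjoint], [free_proj_adjoint]), the discrepancy of the total state
    is [f z + w], the Laplacian of [Q] is the Gram operator [L := f^T f], and the
    term [L_QS u] is [f^T w].  So the flow is [y' = - alpha f^T (f y + w)], and
    the sheaf Poisson equation is the normal equation [L z = - f^T w] of the
    problem of minimizing [|f z + w|].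

    The proposed limit is [z* := y 0 - L^+ f^T (f (y 0) + w)].  As [f^T w] lies in
    the range of [L], the Penrose identities show that [z*] solves the normal
    equation ([gram_normal_sol]); as the range of [L^+] is orthogonal to [ker f],
    so is [y 0 - z*] ([normal_sol_orth]).  Together with Pythagoras these two
    facts give that the solutions form [z* + ker f], that [z*] is the one closest
    to [y 0], and that it minimizes the energy.

    For the convergence, the error [z := y - z*] satisfies [z' = - alpha L z].
    Its component in [ker f] is constant, hence zero ([flow_error_orth]), and on
    the orthogonal complement of [ker f] one has [mu |z|^2 <= |f z|^2] for some
    [mu > 0], because there the pseudoinverse of [f], which is bounded, inverts
    [f] ([coercive_lker_orth]).  Hence
    [(|z|^2)' = - 2 alpha |f z|^2 <= - 2 alpha mu |z|^2], and comparison with an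
    exponential finishes the proof ([flow_error_decay]). *)

(** * Inner products, derivatives and coercivity *)

Section InnerProduct.
Context {R : realType}.
Implicit Types X Y : euclideanType R.

Lemma sqr_norm_dotp {X} (x : X) : `|x| ^+ 2 = dotp x x.
Proof.
rewrite norm_dotp sqr_sqrtr//.
have [->|x0] := eqVneq x 0; first by rewrite linear0r.
exact/ltW/neq0_dnorm_gt0.
Qed.

Lemma sqr_normD {X} (x y : X) :
  `|x + y| ^+ 2 = `|x| ^+ 2 + dotp x y *+ 2 + `|y| ^+ 2.
Proof.
rewrite !sqr_norm_dotp linearDl !linearDr/= (dotpC y x).
by ring.
Qed.

Lemma dotp_inj {X} (a b : X) : (forall z, dotp z a = dotp z b) -> a = b.
Proof.
move=> ab; apply/eqP; rewrite -subr_eq0; apply/eqP/dotp_eq0 => z.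
by rewrite dotpC linearBr/= ab subrr.
Qed.

(** The Cauchy-Schwarz inequality; since the norm is already known to be one, it
    is what the triangle inequality says after squaring. *)
Lemma norm_dotp_le {X} (x y : X) : `|dotp x y| <= `|x| * `|y|.
Proof.
suff le_dotp (z : X) : dotp z y <= `|z| * `|y|.
  by rewrite ler_norml le_dotp andbT lerNl -(normrN x) -linearNl/= le_dotp.
have : `|z + y| ^+ 2 <= (`|z| + `|y|) ^+ 2.
  by rewrite ler_pXn2r ?nnegrE ?addr_ge0// ler_normD.
by rewrite sqr_normD !mulr2n; nra.
Qed.

Lemma pythagoras {X} (x y : X) :
  dotp x y = 0 -> `|x + y| ^+ 2 = `|x| ^+ 2 + `|y| ^+ 2.
Proof. by move=> xy; rewrite sqr_normD xy mul0rn addr0. Qed.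

(** Reduces the joint continuity of the inner product to that of the norm. *)
Lemma dotp_polarization {X} (x y : X) :
  dotp x y = 4^-1 * (`|x + y| ^+ 2 - `|x - y| ^+ 2).
Proof. by rewrite !sqr_normD normrN linearNr/=; field. Qed.

Lemma cvg_dotp {X} {T : Type} {D : set_system T} {FD : Filter D}
    {f g : T -> X} {a b : X} :
  (f t @[t --> D] --> a)%classic -> (g t @[t --> D] --> b)%classic ->
  (dotp (f t) (g t) @[t --> D] --> dotp a b)%classic.
Proof.
move=> fa gb; rewrite dotp_polarization.
under eq_cvg do rewrite dotp_polarization.
apply: cvgM; first exact: cvg_cst.
apply: cvgB; apply: cvgM; apply: cvg_norm.
- exact: cvgD.
- exact: cvgD.
- exact: cvgB.
- exact: cvgB.
Qed.

Lemma is_derive_dotp {X} (f g : R -> X) (t : R) (df dg : X) :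
  is_derive t (1 : R) f df -> is_derive t (1 : R) g dg ->
  is_derive t (1 : R) (fun s => dotp (f s) (g s))
    (dotp df (g t) + dotp (f t) dg).
Proof.
move=> [fd fE] [gd gE].
have cvg_quot (h : R -> X) dh : derivable h t 1 -> 'D_1 h t = dh ->
    (s^-1 *: (h (s *: 1 + t) - h t) @[s --> 0^'] --> dh)%classic.
  by move=> hd <-; exact: hd.
suff quot : (s^-1 *: (dotp (f (s *: 1 + t)) (g (s *: 1 + t)) - dotp (f t) (g t))
    @[s --> (0 : R)^'] --> dotp df (g t) + dotp (f t) dg)%classic.
  by split; [apply/cvg_ex; eexists; exact: quot | exact: cvg_lim quot].
have gcont : (g (s *: 1 + t) @[s --> (0 : R)^'] --> g t)%classic.
  have gcts : {for t, continuous g}.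
    exact/differentiable_continuous/derivable1_diffP.
  apply: (cvg_comp (fun s : R => s *: 1 + t) g _ gcts).
  apply: cvg_trans (_ : (s *: 1 + t @[s --> (0 : R)] --> t)%classic).
    by apply: cvg_app; exact: nbhs_dnbhs.
  rewrite -[X in (_ --> X)%classic]add0r.
  rewrite -[X in (_ --> nbhs (X + _))%classic](scale0r (1 : R)).
  by apply: cvgD; [apply: cvgZr_tmp; exact: cvg_id | exact: cvg_cst].
(* The difference quotient of the product is split as in the Leibniz rule, with
   [g] taken at the moving point: hence the continuity of [g] above. *)
under eq_cvg => s.
  have -> : s^-1 *: (dotp (f (s *: 1 + t)) (g (s *: 1 + t)) - dotp (f t) (g t))
      = dotp (s^-1 *: (f (s *: 1 + t) - f t)) (g (s *: 1 + t))
      + dotp (f t) (s^-1 *: (g (s *: 1 + t) - g t)).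
    rewrite linearZl_LR linearZr_LR/= linearBl linearBr/=.
    by rewrite -[LHS]/(s^-1 * _); ring.
  over.
apply: cvgD; apply: cvg_dotp => //.
- exact: cvg_quot.
- exact: cvg_cst.
- exact: cvg_quot.
Qed.

(** The coordinates in a basis are linear functionals, hence inner products with
    fixed vectors, and so are bounded by Cauchy-Schwarz. *)
Lemma lfun_bounded {X Y} (g : 'Hom(X, Y)) :
  exists2 K : R, 0 < K & forall x, `|g x| <= K * `|x|.
Proof.
pose e := vbasis (@fullv R X).
have [a aE] : exists a : 'I_(\dim {:X}) -> X,
    forall i x, coord e i x = dotp x (a i).
  apply: (@fin_all_exists _ (fun=> X) (fun i a => forall x, coord e i x = dotp x a)).
  by move=> i; apply: dotp_riesz; exact: linearP.
exists (1 + \sum_i `|a i| * `|g e`_i|).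
  by rewrite ltr_pwDl// sumr_ge0// => i _; rewrite mulr_ge0.
move=> x; rewrite {1}(coord_vbasis (memvf x)) linear_sum/=.
apply: le_trans (ler_norm_sum _ _ _) _.
rewrite mulrDl mul1r mulr_suml -[leLHS]add0r lerD// ler_sum// => i _.
rewrite linearZ/= normrZ aE mulrAC ler_wpM2r//.
by rewrite (le_trans (norm_dotp_le _ _))// mulrC.
Qed.

(** [f^+ f] is self-adjoint and [f (f^+ f z) = f z], so for [z] orthogonal to [ker f]
    the vector [f^+ f z - z] lies both in [ker f] and in its orthogonal complement. *)
Lemma pseudoinverse_lker_orth {X Y} (f : 'Hom(X, Y)) z :
  (forall k, f k = 0 -> dotp z k = 0) -> pseudoinverse f (f z) = z.
Proof.
move=> zK; have [fgf _ _ gfA] := pseudoinverseP f.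
set g := pseudoinverse f in fgf gfA *.
have fgfE x : f (g (f x)) = f x by rewrite -[in RHS]fgf !comp_lfunE.
apply/eqP; rewrite -subr_eq0 -normr_eq0 -sqrf_eq0 sqr_norm_dotp; apply/eqP.
have kf : f (g (f z) - z) = 0 by rewrite linearB/= fgfE subrr.
rewrite linearBl/= (zK _ kf) subr0.
have := adjointP (g \o f)%VF z (g (f z) - z); rewrite gfA !comp_lfunE kf linear0 => ->.
by rewrite linear0r.
Qed.

(** The spectral gap of [f^T f], obtained without eigenvalues: on the orthogonal
    complement of [ker f], [|z| = |f^+ (f z)| <= K |f z|] with [K] a bound of [f^+]. *)
Lemma coercive_lker_orth {X Y} (f : 'Hom(X, Y)) :
  exists2 mu : R, 0 < mu & forall z,
    (forall k, f k = 0 -> dotp z k = 0) -> mu * `|z| ^+ 2 <= `|f z| ^+ 2.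
Proof.
have [K K0 gK] := lfun_bounded (pseudoinverse f).
exists (K ^- 2); first by rewrite invr_gt0 exprn_gt0.
move=> z /pseudoinverse_lker_orth {1}<-.
rewrite ler_pdivrMl ?exprn_gt0// -exprMn.
by rewrite ler_pXn2r ?nnegrE ?mulr_ge0// ltW.
Qed.

End InnerProduct.

Lemma within_itv_ray (R : realType) (V : topologicalType) (h : R -> V) (a b : R) :
  {within `[a, +oo[, continuous h}%classic ->
  {within `[a, b], continuous h}%classic.
Proof.
apply: continuous_subspaceW => s /=.
by rewrite !in_itv/= andbT => /andP[].
Qed.

(** * Normal equations and pseudoinverses *)

Section NormalEquations.
Context {R : realType} {X Y : euclideanType R}.
Context (f : 'Hom(X, Y)).

Definition gram : 'Hom(X, X) := (adjoint f \o f)%VF.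

Lemma dotp_gram x z : dotp (gram x) z = dotp (f x) (f z).
Proof. by rewrite comp_lfunE dotpC -adjointP dotpC. Qed.

Lemma gram_eq0 x : (gram x == 0) = (f x == 0).
Proof.
apply/eqP/eqP => [gx|fx]; last by rewrite comp_lfunE fx linear0.
apply/eqP; rewrite -normr_eq0 -sqrf_eq0 sqr_norm_dotp -dotp_gram gx.
by rewrite linear0l.
Qed.

Lemma lker_gram : lker f = lker gram.
Proof. by apply/vspaceP => x; rewrite !memv_ker gram_eq0. Qed.

Lemma gramC x z : dotp (gram x) z = dotp x (gram z).
Proof. by rewrite [RHS]dotpC !dotp_gram dotpC. Qed.

Context (w : Y) (x0 : X).

(** The limit of the flow started at [x0].  Subtracting the pseudoinverse of the
    residual, instead of applying it to [- adjoint f w], selects the solution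
    whose component in the kernel is that of [x0]. *)
Definition normal_sol : X :=
  x0 - pseudoinverse gram (adjoint f (f x0 + w)).

(** Since [L L^+ L = L], it suffices that [L L^+] fixes [c = f^T w].  The remainder
    [r = c - L L^+ c] is killed by [L], hence by [f], so that
    [<r, r> = <c, r> = <w, f r> = 0]. *)
Lemma gram_normal_sol : gram normal_sol = - adjoint f w.
Proof.
have [gpg _ gpA _] := pseudoinverseP gram.
rewrite /normal_sol; set p := pseudoinverse gram in gpg gpA *.
have gpgE x : gram (p (gram x)) = gram x by rewrite -[in RHS]gpg !comp_lfunE.
have range_adjoint : gram (p (adjoint f w)) = adjoint f w.
  set c := adjoint f w; set r := c - gram (p c).
  (* [gram \o p] and [gram] are self-adjoint and [gram \o p \o gram = gram],
     hence also [gram \o gram \o p = gram]. *)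
  have gpC a b : dotp (gram (p a)) b = dotp a (gram (p b)).
    by have := adjointP (gram \o p)%VF a b; rewrite gpA !comp_lfunE.
  have gr : gram r = 0.
    apply: dotp_eq0 => z; rewrite gramC linearBl/= gpC gpgE.
    by rewrite subrr.
  have fr : f r = 0 by apply/eqP; rewrite -gram_eq0 gr.
  apply/esym/eqP; rewrite -subr_eq0 -normr_eq0 -sqrf_eq0 sqr_norm_dotp -/r.
  rewrite {1}/r linearBl/= dotp_gram fr linear0r subr0 dotpC -adjointP fr.
  by rewrite linear0l.
rewrite linearB/= !linearD/= range_adjoint.
have -> : adjoint f (f x0) = gram x0 by rewrite comp_lfunE.
by rewrite gpgE addrA subrr add0r.
Qed.

(** The displacement is in the range of [L^+ = (L^+ L) L^+]; moving the self-adjoint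
    [L^+ L] to the other side of the inner product leaves [L^+ (L k) = 0]. *)
Lemma normal_sol_orth k : f k = 0 -> dotp (x0 - normal_sol) k = 0.
Proof.
move=> fk; rewrite /normal_sol opprB addrC subrK.
have [_ pgp _ pgA] := pseudoinverseP gram.
set p := pseudoinverse gram in pgp pgA *; set c := adjoint f _.
rewrite -pgp 2!comp_lfunE -comp_lfunE adjointP pgA comp_lfunE.
have -> : gram k = 0 by apply/eqP; rewrite gram_eq0 fk.
by rewrite !linear0.
Qed.

Lemma normal_equation_subr z :
  (gram z == - adjoint f w) = (z - normal_sol \in lker f).
Proof.
by rewrite memv_ker -gram_eq0 linearB/= gram_normal_sol subr_eq0.
Qed.

Lemma normal_solutions_affine :
  affine_subspace [set z | gram z = - adjoint f w]%classic (lker f).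
Proof.
exists normal_sol; apply/seteqP.
by split=> z /=; rewrite -normal_equation_subr => /eqP.
Qed.

Lemma normal_sol_closest :
  closest_point [set z | gram z = - adjoint f w]%classic x0 normal_sol.
Proof.
split=> [|z /eqP]; first exact: gram_normal_sol.
rewrite normal_equation_subr -[z == _]subr_eq0 memv_ker => /eqP fz z0.
rewrite -(ltr_pXn2r (n := 2)) ?nnegrE//.
rewrite -[x0 - z](subrKA normal_sol) (@pythagoras _ _ _ (normal_sol - z)).
  by rewrite ltrDl exprn_gt0// normr_gt0 -opprB oppr_eq0.
by rewrite normal_sol_orth// -opprB -scaleN1r linearZ/= fz scaler0.
Qed.

(** By the normal equation the residual of [normal_sol] is orthogonal to the range
    of [f]. *)
Lemma normal_sol_minimizes z : `|f normal_sol + w| <= `|f z + w|.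
Proof.
rewrite -(ler_pXn2r (n := 2)) ?nnegrE//.
have -> : f z + w = f normal_sol + w + f (z - normal_sol).
  by rewrite [f (z - _)]linearB [f normal_sol + w]addrC -addrA subrKC addrC.
rewrite [leRHS]pythagoras ?lerDl ?sqr_ge0//.
rewrite dotpC adjointP [adjoint f _]linearD/=.
have -> : adjoint f (f normal_sol) = gram normal_sol by rewrite comp_lfunE.
by rewrite gram_normal_sol addNr linear0r.
Qed.

(** * Gradient flow of a least-squares problem *)

Section Flow.
Context (alpha : R) (y : R -> X).
Context (alpha_gt0 : 0 < alpha) (y0 : y 0 = x0).
Context (y_ode : solves_ode y (fun z => - (alpha *: adjoint f (f z + w)))).

Let z t := y t - normal_sol.

Lemma flow_gradientE x : adjoint f (f x + w) = gram (x - normal_sol).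
Proof. by rewrite linearB/= gram_normal_sol opprK linearD/= comp_lfunE. Qed.

Lemma flow_error_derive (t : R) : 0 < t ->
  is_derive t (1 : R) z (- (alpha *: gram (z t))).
Proof.
move=> t0; have [_ /(_ t t0)] := y_ode; rewrite flow_gradientE => dy.
rewrite -[X in is_derive _ _ _ X]subr0.
exact: is_deriveB.
Qed.

Lemma flow_error_within : {within `[0, +oo[, continuous z}%classic.
Proof.
have [yc _] := y_ode; move=> t; apply: cvgB; first exact: yc.
exact: cvg_cst.
Qed.

(** The inner product of the error with [k] has derivative
    [- alpha <f z, f k> = 0], so it keeps its initial value, which is zero by
    [normal_sol_orth]. *)
Lemma flow_error_orth (t : R) k : 0 <= t -> f k = 0 -> dotp (z t) k = 0.
Proof.
move=> t0 fk; have <- : dotp (z 0) k = 0 by rewrite /z y0 normal_sol_orth.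
have dk (s : R) : 0 < s -> is_derive s (1 : R) (fun r => dotp (z r) k) 0.
  move=> s0.
  have := is_derive_dotp _ _ _ _ _ (flow_error_derive s s0) (is_derive_cst k s 1).
  rewrite linear0r addr0 linearNl/= linearZl_LR/= dotp_gram fk linear0r.
  by rewrite mulr0 oppr0.
have [||c _] := @MVT_segment R (fun s => dotp (z s) k) (fun=> 0) 0 t t0.
- by move=> s; rewrite in_itv/= => /andP[s0 _]; exact: dk.
- apply: within_itv_ray.
  move=> s; apply: cvg_dotp; [exact: flow_error_within|exact: cvg_cst].
by rewrite mul0r => /eqP; rewrite subr_eq0 => /eqP.
Qed.

(** By coercivity [|z|^2 exp (2 alpha mu t)] has nonpositive derivative. *)
Lemma flow_error_decay : exists2 rate : R, 0 < rate &
  forall t : R, 0 <= t -> `|z t| <= `|z 0| * expR (- rate * t).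
Proof.
have [mu mu0 coercive] := coercive_lker_orth f.
exists (alpha * mu); first exact: mulr_gt0.
move=> t t0; rewrite -(ler_pXn2r (n := 2)) ?nnegrE ?mulr_ge0 ?expR_ge0//.
rewrite exprMn -expRM_natl mulrA mulrN mulNr expRN.
rewrite ler_pdivlMr ?expR_gt0//.
pose rho := 2%:R * (alpha * mu).
pose g s := dotp (z s) (z s) * expR (rho * s).
have dg (s : R) : 0 < s -> is_derive s (1 : R) g
    (2 * alpha * expR (rho * s) * (mu * `|z s| ^+ 2 - `|f (z s)| ^+ 2)).
  move=> s0; have dz := flow_error_derive s s0.
  have de : is_derive s (1 : R) (fun r => expR (rho * r)) (rho * expR (rho * s)).
    have := is_derive1_comp (is_derive_expR (rho * s))
      (is_deriveZ rho (is_derive_id s 1)).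
    by rewrite [X in is_derive _ _ _ X]mulrC /GRing.scale/= mulr1.
  have := is_deriveM (is_derive_dotp _ _ _ _ _ dz dz) de.
  congr is_derive; rewrite [dotp (z s) (- _)]dotpC.
  have -> : dotp (- (alpha *: gram (z s))) (z s) = - (alpha * `|f (z s)| ^+ 2).
    by rewrite linearNl/= [dotp (_ *: _) _]linearZl_LR/= dotp_gram sqr_norm_dotp.
  by rewrite -sqr_norm_dotp /GRing.scale/= /rho; ring.
suff : g t <= g 0 by rewrite /g mulr0 expR0 mulr1 -!sqr_norm_dotp.
apply: (@ler0_derive1_le_cc R g 0 t) => //.
- by move=> s; rewrite in_itv/= => /andP[s0 _]; case: (dg s s0).
- move=> s; rewrite in_itv/= => /andP[s0 _].
  rewrite derive1E (@derive_val _ _ _ _ _ _ _ (dg s s0)).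
  rewrite pmulr_rle0 ?mulr_gt0 ?expR_gt0// subr_le0 coercive// => k.
  exact: flow_error_orth _ _ (ltW s0).
- apply: within_itv_ray.
  move=> s; apply: cvgM; first by apply: cvg_dotp; exact: flow_error_within.
  apply: continuous_subspaceT => r.
  apply: (cvg_comp _ expR _ (@continuous_expR R _)).
  by apply: cvgM; [exact: cvg_cst|exact: cvg_id].
- by rewrite in_itv/= lexx t0.
- by rewrite in_itv/= lexx t0.
Qed.

Lemma flow_converges : converges_exponentially y normal_sol.
Proof.
have [rate rate0 decay] := flow_error_decay.
split; last by exists `|z 0|, rate; split.
apply: (@cvg_sub0 _ _ _ _ _ y (fun=> normal_sol)); last by exact: cvg_cst.
apply: norm_cvg0.
apply: (@squeeze_cvgr _ _ _ _ (fun=> 0) (fun t => `|z 0| * expR (- rate * t))).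
- near=> t; rewrite normr_ge0/=; apply: decay.
  by near: t; exact: nbhs_pinfty_ge (num_real 0).
- exact: cvg_cst.
rewrite -[X in (_ --> X)%classic](mulr0 `|z 0|); apply: cvgM; first exact: cvg_cst.
under eq_cvg do rewrite mulNr.
apply: (@cvg_comp _ _ _ (fun t => rate * t) (fun t => expR (- t)) _ (pinfty_nbhs R)).
  exact: gt0_cvgMry.
exact: cvgr_expR.
Unshelve. all: by end_near. Qed.

End Flow.
End NormalEquations.

(** * Splitting into stubborn and free cochains *)

Section Splitting.
Context {R : realType} {G : graph}.
Context (o : orientation G) (F : sheaf R G).
Context (S : forall v : vertex G, {vspace vstalk F v}).

Lemma C0_incl_adjoint (A : forall v, {vspace vstalk F v}) :
  is_adjoint (C0_incl A) (C0_proj A).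
Proof.
move=> x z; rewrite !dotp_dsumE; apply: eq_bigr => v _.
rewrite C0_inclE C0_projE dotp_subvsE; set zv := Defs.dcomp v z.
rewrite -[in LHS](subrKC (vsval (orthproj (A v) zv)) zv).
rewrite linearDr/= -[RHS]addr0; congr (_ + _); rewrite dotpC.
by have /mem_orthovP -> := orthproj_sub (A v) zv; rewrite ?subvsP.
Qed.

Lemma C0_proj_orth (A : forall v, {vspace vstalk F v}) (x : C0 F) :
  (forall v, Defs.dcomp v x \in orthov dotp (A v)) -> C0_proj A x = 0.
Proof.
move=> xA; apply: dotp_eq0 => z; rewrite dotpC -C0_incl_adjoint dotp_dsumE.
apply: big1 => v _; rewrite C0_inclE dotpC.
by have /mem_orthovP -> := xA v; rewrite ?subvsP.
Qed.

Lemma dotp_C0_incl (A : forall v, {vspace vstalk F v}) x z :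
  dotp (C0_incl A x) (C0_incl A z) = dotp x z.
Proof. by rewrite !dotp_dsumE; apply: eq_bigr => v _; rewrite !C0_inclE. Qed.

Lemma C0_inclK (A : forall v, {vspace vstalk F v}) x :
  C0_proj A (C0_incl A x) = x.
Proof.
by apply: dotp_inj => z; rewrite -C0_incl_adjoint dotp_C0_incl.
Qed.

Lemma stubborn_proj_free y : C0_proj S (free_incl S y) = 0.
Proof. by apply: C0_proj_orth => v; rewrite C0_inclE subvsP. Qed.

(** The orthogonal splitting of cochains turns the constrained minimization into an
    unconstrained one over the free cochains. *)
Lemma stubborn_constraintP (x : C0 F) u :
  C0_proj S x = u -> exists q, x = C0_incl S u + free_incl S q.
Proof.
move=> xu.
have xT v : Defs.dcomp v (x - C0_incl S u) \in free_dirs S v.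
  by rewrite linearB/= C0_inclE -xu C0_projE orthproj_sub.
exists (mk_dsum (fun v => vsproj (free_dirs S v) (Defs.dcomp v (x - C0_incl S u)))).
apply/dsumP => v; rewrite linearD/= !C0_inclE mk_dsumE vsprojK ?xT//.
by rewrite linearB/= C0_inclE subrKC.
Qed.

Lemma coboundary_free y :
  coboundary o (free_sheaf S) y = coboundary o F (free_incl S y) :> C1 F.
Proof.
rewrite !coboundaryE; apply/dsumP => e; rewrite !mk_dsumE /= !comp_lfunE.
by rewrite !C0_inclE !lfunE.
Qed.

(** The adjoint of [coboundary_free]: restricting the coboundary to free cochains
    amounts to projecting the values of its adjoint onto them. *)
Lemma free_proj_adjoint (c : C1 F) :
  free_proj S (adjoint (coboundary o F) c)
  = adjoint (coboundary o (free_sheaf S)) (c : C1 (free_sheaf S)).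
Proof.
apply: dotp_inj => z; rewrite -[LHS]C0_incl_adjoint -!adjointP.
by rewrite coboundary_free.
Qed.

End Splitting.

(** * Convergence of the stubborn opinion dynamics *)

Theorem theorem3p2 (R : realType) (G : graph) (o : orientation G)
    (connG : connected_graph G) (F : sheaf R G)
    (U : {set vertex G}) (S : forall v : vertex G, {vspace vstalk F v})
    (S_free : forall v : vertex G, v \notin U -> S v = 0%VS)
    (u : C0sub S) (alpha : R) (alpha_gt0 : 0 < alpha)
    (y : R -> C0 (free_sheaf S))
    (y_ode : solves_ode y (fun z => - (alpha *:
       (laplacian o (free_sheaf S) z + laplacian_QS o S u)))) :
  let Q := free_sheaf S in
  let x0 := C0_incl S u + free_incl S (y 0) in
  let A := [set z : C0 Q | laplacian o Q z = - laplacian_QS o S u]%classic in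
  exists yinf : C0 Q,
    [/\ converges_exponentially y yinf,
        laplacian o Q yinf = - laplacian_QS o S u,
        [/\ affine_subspace A (H0 o Q), H0 o Q = lker (laplacian o Q),
            closest_point A (y 0) yinf &
            yinf = y 0 - pseudoinverse (laplacian o Q)
                           (free_proj S (laplacian o F x0))] &
        argmin [set x : C0 F | C0_proj S x = u]%classic
          (fun x => `|coboundary o F x| ^+ 2)
          (C0_incl S u + free_incl S yinf)].
Proof.
move=> Q x0 A.
pose f := coboundary o Q; pose w : C1 Q := coboundary o F (C0_incl S u).
have LQS : laplacian_QS o S u = adjoint f w.
  by rewrite /laplacian_QS !comp_lfunE free_proj_adjoint.
have AE : A = [set z | gram f z = - adjoint f w]%classic by rewrite /A LQS.
have energyE z : coboundary o F (C0_incl S u + free_incl S z) = f z + w :> C1 Q.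
  by rewrite linearD/= -coboundary_free addrC.
exists (normal_sol f w (y 0)); split.
- apply: (flow_converges f w (y 0) alpha y alpha_gt0 erefl).
  move: y_ode; congr solves_ode; apply/funext => z; congr (- (alpha *: _)).
  by rewrite LQS linearD/= -comp_lfunE.
- by rewrite LQS; exact: (gram_normal_sol f w (y 0)).
- split.
  + by rewrite AE; exact: (normal_solutions_affine f w (y 0)).
  + exact: (lker_gram f).
  + by rewrite AE; exact: (normal_sol_closest f w (y 0)).
  + by rewrite /normal_sol [laplacian o F x0]comp_lfunE free_proj_adjoint energyE.
- split=> [|x /stubborn_constraintP[q ->]].
    by rewrite /= linearD/= C0_inclK stubborn_proj_free addr0.
  rewrite !energyE ler_pXn2r ?nnegrE//.
  exact: (normal_sol_minimizes f w (y 0)).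
Qed.
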